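(* Let $(\Gamma,G)\in\mathcal{OG}(4)$, and suppose that $\Gamma$ is a weak $(m,n)$-metacirculant relative to $(\rho,\lambda)$ for some $\rho,\lambda\in G$. Let $R=\langle\rho\rangle$, and suppose that the quotient graph $\Gamma_R$ of $\Gamma$ modulo the $R$-orbits on vertices is a cyclic, $G$-oriented, normal quotient of $(\Gamma,G)$ of length at least $3$. Suppose also that $(\Gamma,G)$ has independent cyclic normal quotients $\Gamma_N\cong C_r$ and $\Gamma_M\cong C_s$, where $r\ge3$, $s\ge3$ (at least one of two such quotients is always $G$-unoriented, and they are labelled so that $\Gamma_N$ is $G$-unoriented). Then, for these $r,s$, $(\Gamma,G)$ is a normal cover of a pair $(\overline{\Gamma},\overline{G})\in\mathcal{OG}(4)$ such that $\overline{\Gamma}$ is a weak $(\overline{m},\overline{n})$-metacirculant relative to $(\overline{\rho},\overline{\lambda})$ and one of the following holds: 1. at least one of $r,s$ is odd, $\overline{m}=s$, $\overline{n}=r$, $\overline{\Gamma}=\Gamma(r,s)$, $\overline{G}=G(r,s)$, $\overline{\rho}=\mu$, $\overline{\lambda}=\nu$ (the name for $\overline{\Gamma}$ used by Marušič and Šparl is $X_o(s,r;1)$); 2. $r,s$ are both even, $\overline{m}=s$, $\overline{n}=r/2$, $\overline{\Gamma}=\Gamma^+(r,s)$, $\overline{G}=G^+(r,s)$, $\overline{\rho}=\mu^2$, $\overline{\lambda}=\mu\nu$ (the name for $\overline{\Gamma}$ used by Marušič and Šparl is $X_e(s,r/2;1,0)$).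
   Context: $\mathcal{OG}(4)$ is the family of all pairs $(\Gamma,G)$ where $\Gamma$ is a finite simple connected undirected graph of valency $4$ and $G\leq\mathrm{Aut}(\Gamma)$ is a vertex-transitive and edge-transitive group of automorphisms with a specified $G$-orbit $\Delta$ on ordered pairs of vertices consisting of exactly one ordered pair for each edge. The edge $\{x,y\}$ is oriented from $x$ to $y$ (written $x\rightarrow y$) if $(x,y)\in\Delta$. For $N\unlhd G$, the normal quotient $\Gamma_N$ is the graph whose vertices are the $N$-orbits on vertices, two distinct $N$-orbits $B,C$ being adjacent iff there is an edge $\{x,y\}$ of $\Gamma$ with $x\in B$, $y\in C$. There is a constant $\ell$, independent of the adjacent pair $B,C$, such that each vertex of $B$ is joined to exactly $\ell$ vertices of $C$; if $\ell=1$ then $(\Gamma,G)$ is called a normal cover of $(\Gamma_N,G/N)$ ($N=1$ is allowed). $C_r$ is a cycle of length $r$; a cyclic normal quotient is a normal quotient that is a cycle. It is $G$-oriented if it inherits a $G$-invariant edge-orientation from $\Gamma$ (for adjacent $N$-orbits $B,C$ all edges of $\Gamma$ between $B$ and $C$ are oriented in the same direction), and $G$-unoriented otherwise. Two cyclic normal quotients $\Gamma_M,\Gamma_N$ are independent if $\Gamma_K$ is not a cycle, where $K=\tilde N\cap\tilde M$ and $\tilde N$, $\tilde M$ are the subgroups of all elements of $G$ fixing setwise each $N$-orbit, respectively each $M$-orbit. A graph $\Gamma$ is a weak $(m,n)$-metacirculant relative to an ordered pair $(\rho,\lambda)$ of its automorphisms if $\Gamma$ has $mn$ vertices, $\rho$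 has $m$ cycles of length $n$ on vertices, $\langle\lambda\rangle$ permutes the $\rho$-cycles transitively, and $\rho^\lambda=\rho^k$ for some $k$ with $\gcd(k,n)=1$. For $R=\langle\rho\rangle$ (not assumed normal in $G$), $\Gamma_R$ is the graph on the $R$-orbits with adjacency defined as for normal quotients; $\Gamma_R$ is a normal quotient of $(\Gamma,G)$ if there is a normal subgroup of $G$ with the same vertex-orbits as $R$. Pairs $(\Gamma,G)$, $(\Gamma',G')$ are isomorphic if there are a graph isomorphism $f:\Gamma\to\Gamma'$ and a group isomorphism $\varphi:G\to G'$ with $(x^g)f=(xf)^{g\varphi}$ for all vertices $x$ and $g\in G$; the identifications of $(\overline{\Gamma},\overline{G})$ in the claim are up to such isomorphism. For integers $r,s\ge3$, $\Gamma(r,s)$ is the graph with vertex set $X=\mathbb{Z}_r\times\mathbb{Z}_s$ in which $(i,j)$ is adjacent to the four vertices $(i\pm1,j\pm1)$. If $r,s$ are both even, $X^+=\{(i,j)\in X : i,j \text{ of the same parity}\}$ and $\Gamma^+(r,s)$ is the subgraph induced on $X^+$. Define $\mu:(i,j)\mapsto(i+1,j)$, $\nu:(i,j)\mapsto(i,j+1)$, $\sigma:(i,j)\mapsto(-i,j)$, $G(r,s)=\langle\mu,\nu,\sigma\rangle$ and, for $r,s$ both even, $G^+(r,s)=\langle\mu^2,\mu\nu,\sigma\rangle$ acting on $X^+$ (with $\mu^2,\mu\nu,\sigma$ restricted to $X^+$). The edge-orientation is $(i,j)\rightarrow(i\pm1,j+1)$ (restricted to $X^+$ in the case of $\Gamma^+(r,s)$).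 The names $X_o(s,r;1)$ and $X_e(s,r/2;1,0)$ only record the notation for these graphs in the work of Marušič and Šparl on weak metacirculants.
   Formalization: The stated conclusion for r,s is proved when Γ_M is G-oriented; when Γ_M is also G-unoriented the claim is false as stated (e.g. Γ⁺(8,4) with unoriented quotients C_4, C_8), and it is proved with s replaced by the length of the oriented quotient Γ_R. *)

(* Defs.v *)
From HB Require Import structures.
From mathcomp Require Import all_boot all_order all_algebra all_fingroup.

Set Implicit Arguments.
Unset Strict Implicit.
Unset Printing Implicit Defensive.

Import GroupScope.

Definition simple_graph (T : finType) (e : rel T) : Prop :=
  symmetric e /\ irreflexive e.

Definition graph_aut (T : finType) (e : rel T) : {set {perm T}} :=
  [set p : {perm T} | [forall x, forall y, e (p x) (p y) == e x y]].

Definition isomorphic_graphs (T1 T2 : finType) (e1 : rel T1) (e2 : rel T2) :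
    Prop :=
  exists f : T1 -> T2, bijective f /\ forall x y, e2 (f x) (f y) = e1 x y.

(* Only meaningful for l >= 2, since 'Z_0 and 'Z_1 are also Z / 2. *)
Definition cycle_adj (l : nat) : rel 'Z_l :=
  fun i j => (j == i + 1)%R || (j == i - 1)%R.

Definition edges (T : finType) (e : rel T) : {set {set T}} :=
  [set [set p.1; p.2] | p : T * T & e p.1 p.2].

Definition is_orientation (T : finType) (e : rel T) (G : {group {perm T}})
    (D : {set T * T}) : Prop :=
  [/\ exists a : T * T, D = [set ((g : {perm T}) a.1, g a.2) | g in G],
      forall x y, (x, y) \in D -> e x y &
      forall x y, e x y -> ((x, y) \in D) (+) ((y, x) \in D)].

(* The vertex set is nonempty because [setT] is required to be an orbit. *)
Record OG4 (T : finType) (e : rel T) (G : {group {perm T}})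
    (D : {set T * T}) : Prop := IsOG4 {
  OG4_simple : simple_graph e;
  OG4_connected : forall x y, connect e x y;
  OG4_valency : forall x, #|[set y | e x y]| = 4;
  OG4_aut : G \subset graph_aut e;
  OG4_vertex_transitive : [transitive G, on [set: T] | 'P];
  OG4_edge_transitive : [transitive G, on edges e | 'P^*];
  OG4_orientation : is_orientation e G D
}.

Section Quotients.

Variables (T : finType) (e : rel T) (G : {group {perm T}}) (D : {set T * T}).

Definition orbits (N : {set {perm T}}) : {set {set T}} :=
  [set orbit 'P N x | x : T].

Definition qvert (N : {set {perm T}}) : finType :=
  {B : {set T} | B \in orbits N}.

Definition qadj (N : {set {perm T}}) : rel (qvert N) :=
  fun B C => (B != C) && [exists x in val B, exists y in val C, e x y].

Definition quotient_is_cycle (N : {set {perm T}}) (l : nat) : Prop :=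
  isomorphic_graphs (@qadj N) (@cycle_adj l).

Definition cyclic_quotient (N : {set {perm T}}) : Prop :=
  exists2 l, 3 <= l & quotient_is_cycle N l.

Definition oriented_quotient (N : {set {perm T}}) : Prop :=
  forall B C : qvert N, qadj B C ->
  forall x x' y y' : T,
    [/\ x \in val B, y \in val C & e x y] ->
    [/\ x' \in val B, y' \in val C & e x' y'] ->
    ((x, y) \in D) = ((x', y') \in D).

Definition is_normal_quotient (R : {set {perm T}}) : Prop :=
  exists2 L : {group {perm T}}, L <| G & orbits L = orbits R.

Definition orbit_ker (N : {set {perm T}}) : {group {perm T}} :=
  'C_G(orbits N | 'P^*)%G.

Definition independent_quotients (N M : {set {perm T}}) : Prop :=
  ~ cyclic_quotient (orbit_ker N :&: orbit_ker M).

Definition cover_index_one (N : {set {perm T}}) : Prop :=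
  forall B C : qvert N, qadj B C ->
  forall x, x \in val B -> #|[set y in val C | e x y]| = 1%N.

(* [N] fixes each of its orbits, so ['P^*] induces an action of cosets of [N]
   on these orbits; see [quotient_actE]. *)
Definition quotient_act (N : {group {perm T}}) :=
  (('P^* %% N)^? : action _ (qvert N))%act.

Lemma quotient_actE (N : {group {perm T}}) (g : {perm T}) (B : qvert N) :
  g \in 'N(N) -> val (quotient_act N B (coset N g)) = g @: val B.
Proof.
move=> nNg.
have fixN C : C \in orbits N -> C \in 'Fix_('P^*)(setT :&: N)%act.
  case/imsetP=> x _ ->; apply/afixP=> a /setIP[_ Na].
  exact/astabs_setact/(subsetP (acts_orbit 'P x (subsetT N))).
have orbN C : C \in orbits N -> ('P^*)%act C g \in orbits N.
  case/imsetP=> x _ ->; apply/imsetP; exists (g x) => //.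
  apply/setP=> y; apply/imsetP/imsetP=> [[_ /imsetP[a Na ->] ->]|[a Na ->]].
    by exists (a ^ g); rewrite ?memJ_norm //= !apermE !permM permK.
  exists (aperm x (a ^ g^-1)).
    by apply: imset_f; rewrite memJ_norm ?groupV.
  by rewrite /= !apermE conjgE invgK !permM permKV.
have actE C : C \in orbits N -> ('P^* %% N)%act C (coset N g) = ('P^*)%act C g.
  by move=> oC; apply: modactE; [rewrite inE | exact: nNg | exact: fixN].
rewrite val_subact ifT ?actE ?(valP B) // inE; apply/andP; split.
  by rewrite mem_quotient ?inE.
rewrite inE; apply/subsetP=> C; rewrite !inE => oC.
by rewrite actE ?orbN.
Qed.

End Quotients.

(* Isomorphism of pairs (graph, group acting on its vertices): the graph
   isomorphism [f] intertwines the actions along the group isomorphism [phi]. *)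
Definition isomorphic_pairs (T1 T2 : finType) (e1 : rel T1) (e2 : rel T2)
    (gT1 gT2 : finGroupType) (G1 : {group gT1}) (G2 : {group gT2})
    (D1 : {group gT1}) (D2 : {group gT2})
    (to1 : action D1 T1) (to2 : action D2 T2) : Prop :=
  exists f : T1 -> T2, exists phi : {morphism G1 >-> gT2},
  [/\ bijective f, forall x y, e2 (f x) (f y) = e1 x y, isom G1 G2 phi &
      forall x g, g \in G1 -> f (to1 x g) = to2 (f x) (phi g)].

Definition normal_cover (T1 T2 : finType) (e1 : rel T1) (e2 : rel T2)
    (G1 : {group {perm T1}}) (G2 : {group {perm T2}}) : Prop :=
  exists N : {group {perm T1}},
  [/\ N <| G1, cover_index_one e1 N &
      isomorphic_pairs (@qadj T1 e1 N) e2 (G1 / N)%G G2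
        (quotient_act N) 'P%act].

Definition weak_metacirculant (m n : nat) (T : finType) (e : rel T)
    (rho lambda : {perm T}) : Prop :=
  [/\ rho \in graph_aut e /\ lambda \in graph_aut e,
      #|T| = (m * n)%N,
      #|porbits rho| = m /\ (forall x, #|porbit rho x| = n),
      [transitive <[lambda]>, on porbits rho | 'P^*] &
      exists2 k, coprime k n & rho ^ lambda = rho ^+ k].

Section Standard.

Variables r s : nat.

Definition stdX : finType := ('Z_r * 'Z_s)%type.

Definition std_adj : rel stdX := fun p q =>
  ((q.1 == p.1 + 1) || (q.1 == p.1 - 1))%R &&
  ((q.2 == p.2 + 1) || (q.2 == p.2 - 1))%R.

Definition std_arcs : {set stdX * stdX} :=
  [set a | ((a.2.1 == a.1.1 + 1) || (a.2.1 == a.1.1 - 1))%R &&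
           (a.2.2 == a.1.2 + 1)%R].

Lemma mu_inj : injective (fun p : stdX => (p.1 + 1, p.2)%R : stdX).
Proof.
apply: (can_inj (g := fun p : stdX => (p.1 - 1, p.2)%R : stdX)) => -[a b] /=.
by rewrite GRing.addrK.
Qed.

Lemma nu_inj : injective (fun p : stdX => (p.1, p.2 + 1)%R : stdX).
Proof.
apply: (can_inj (g := fun p : stdX => (p.1, p.2 - 1)%R : stdX)) => -[a b] /=.
by rewrite GRing.addrK.
Qed.

Lemma sigma_inj : injective (fun p : stdX => (- p.1, p.2)%R : stdX).
Proof.
apply: (can_inj (g := fun p : stdX => (- p.1, p.2)%R : stdX)) => -[a b] /=.
by rewrite GRing.opprK.
Qed.

Definition mu : {perm stdX} := perm mu_inj.
Definition nu : {perm stdX} := perm nu_inj.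
Definition sigma : {perm stdX} := perm sigma_inj.

Definition std_group : {group {perm stdX}} := <<[set mu; nu; sigma]>>%G.

(* The parity condition, [stdXp], and what follows are only used for r and s
   both even, when the parity of an element of 'Z_r or 'Z_s makes sense. *)
Definition same_parity : pred stdX := fun p => odd p.1 == odd p.2.

Definition stdXp : finType := {p : stdX | same_parity p}.

Definition stdp_adj : rel stdXp := fun p q => std_adj (val p) (val q).

Definition stdp_arcs : {set stdXp * stdXp} :=
  [set a | (val a.1, val a.2) \in std_arcs].

(* Restriction to [stdXp] of a permutation that preserves [same_parity]
   (the identity for other permutations); see [stdp_restrE]. *)
Definition stdp_restr (p : {perm stdX}) : {perm stdXp} :=
  actperm ('P^? : action _ stdXp)%act p.

Lemma stdp_restrE (p : {perm stdX}) :
  (forall x, same_parity (p x) = same_parity x) ->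
  forall u : stdXp, val (stdp_restr p u) = p (val u).
Proof.
move=> pP u; rewrite actpermE val_subact ifT //.
by rewrite !inE; apply/subsetP=> x; rewrite !inE /= apermE pP.
Qed.

Definition std_mu2 : {perm stdXp} := stdp_restr (mu ^+ 2).
Definition std_munu : {perm stdXp} := stdp_restr (mu * nu).
Definition std_sigma : {perm stdXp} := stdp_restr sigma.

Definition stdp_group : {group {perm stdXp}} :=
  <<[set std_mu2; std_munu; std_sigma]>>%G.

End Standard.


Definition covers_standard_metacirculant (T : finType) (e : rel T)
    (G : {group {perm T}}) (r s : nat) : Prop :=
  [/\ odd r || odd s,
      OG4 (@std_adj r s) (std_group r s) (std_arcs r s),
      weak_metacirculant s r (@std_adj r s) (mu r s) (nu r s) &
      normal_cover e (@std_adj r s) G (std_group r s)]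
  \/
  [/\ ~~ odd r && ~~ odd s,
      OG4 (@stdp_adj r s) (stdp_group r s) (stdp_arcs r s),
      weak_metacirculant s r./2 (@stdp_adj r s) (std_mu2 r s) (std_munu r s) &
      normal_cover e (@stdp_adj r s) G (stdp_group r s)].

(* Main.v *)
Require Import Defs.
From mathcomp Require Import all_boot all_order all_algebra all_fingroup.
From mathcomp Require Import ring.
Import GroupScope GRing.Theory.

(** Let [a : T -> 'Z_r] and [b : T -> 'Z_s] be the positions on the two cycles,
[a] for the unoriented quotient and [b] for the oriented one. Up to the sign of
[b], every arc raises [b] by 1, so [G] acts on [b] by translations and on [a] by
maps [i |-> +- i + c]. Since the first quotient is not oriented, some element of
[G] fixes a vertex and reverses [a] around it; with vertex-transitivity, [G]
realises every pair (image of a vertex, sign on [a]). Hence a vertex has a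
neighbour in each of the four directions [(+-1, +-1)], exactly one by valency 4,
so [(a, b)] is a covering of a connected component of the standard graph; its
fibres are the orbits of the kernel of the action on [(a, b)], and the induced
group consists of all maps [(i, j) |-> (+- i + c, j + c')] of that component. *)

Set Implicit Arguments.
Unset Strict Implicit.
Unset Printing Implicit Defensive.

(** * Orbits as quotient vertices, and a criterion for normal covers *)

Definition qclass (T : finType) (N : {set {perm T}}) (x : T) : qvert N :=
  exist (fun B => B \in orbits N) (orbit 'P N x) (imset_f _ isT).

Lemma qclassP (T : finType) (N : {set {perm T}}) (B : qvert N) :
  exists x, B == qclass N x.
Proof.
by have /imsetP[x _ Bx] := valP B; exists x; rewrite -val_eqE /= Bx.
Qed.

Section NormalCover.

Variables (T V : finType) (e : rel T) (e' : rel V).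
Variables (G : {group {perm T}}) (H : {group {perm V}}) (phi : T -> V).

(** The normal subgroup is the kernel of the homomorphism [G -> H] induced along [phi]. The fibre
    hypothesis makes its orbits the fibres of [phi], so the quotient graph is [e']; lifting and
    local injectivity of [phi] give one neighbour in each adjacent orbit. *)
Lemma normal_cover_of_map :
    irreflexive e' ->
    (forall v, exists x, phi x = v) ->
    (forall g, g \in G ->
       exists2 p, p \in H & forall x, p (phi x) = phi (g x)) ->
    (forall p, p \in H ->
       exists2 g, g \in G & forall x, p (phi x) = phi (g x)) ->
    (forall x y, phi x = phi y ->
       exists g : {perm T},
         [/\ g \in G, forall z, phi (g z) = phi z & g x = y]) ->
    (forall x y, e x y -> e' (phi x) (phi y)) ->
    (forall x v, e' (phi x) v -> exists2 y, e x y & phi y = v) ->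
    (forall x y z, e x y -> e x z -> phi y = phi z -> y = z) ->
  normal_cover e e' G H.
Proof.
move=> irr' surj GH HG fib homo lift inj.
(* The induced permutation is unique because [phi] is surjective; the default [1] only occurs
   outside [G]. *)
pose ind (g : {perm T}) : {perm V} :=
  odflt 1 [pick p : {perm V} in H | [forall x, p (phi x) == phi (g x)]].
have indP g : g \in G -> ind g \in H /\ forall x, ind g (phi x) = phi (g x).
  move=> /GH[p pH pE]; rewrite /ind; case: pickP => [q /andP[qH /forallP qE]|].
    by split=> // x; apply/eqP.
  by move=> /(_ p); rewrite /= pH => /negP[]; apply/forallP=> x; rewrite pE.
have eqV (p q : {perm V}) : (forall x, p (phi x) = q (phi x)) -> p = q.
  by move=> pq; apply/permP=> v; have [x <-] := surj v.
have indM : {in G &, {morph ind : g h / g * h}}.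
  move=> g h gG hG; apply: eqV => x.
  have [_ ->] := indP _ (groupM gG hG).
  have [[_ gE] [_ hE]] := (indP _ gG, indP _ hG).
  by rewrite !permM gE hE.
pose f := Morphism indM; pose K := ('ker f)%G.
have nKG : K <| G by apply: ker_normal.
have KP g : reflect (g \in G /\ forall x, phi (g x) = phi x) (g \in K).
  apply: (iffP idP) => [gK|[gG gE]].
    have gG : g \in G by apply: (subsetP (normal_sub nKG)).
    have [_ gE] := indP _ gG; split=> // x; rewrite -gE.
    by have -> : ind g = 1 := mker gK; rewrite perm1.
  have [_ gE'] := indP _ gG; apply/kerP => //=.
  by apply: eqV => x; rewrite gE' gE perm1.
have orbE x y : (y \in orbit 'P K x) = (phi x == phi y).
  apply/imsetP/eqP=> [[g /KP[_ gE] ->]|/fib[g [gG gE <-]]].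
    by rewrite /= apermE gE.
  by exists g => //; apply/KP.
pose cl := qclass K; have clP (B : qvert K) : exists x, B == cl x := qclassP B.
(* The representative does not matter, since [phi] is constant on [K]-orbits by [orbE]. *)
pose F (B : qvert K) := phi (xchoose (clP B)).
have FE x : F (cl x) = phi x.
  rewrite /F; have := xchooseP (clP (cl x)); set y := xchoose _.
  move/eqP/(congr1 val) => /= xy; apply/esym/eqP; rewrite -orbE xy.
  exact: orbit_refl.
have clE x y : (cl x == cl y) = (phi x == phi y).
  rewrite -orbE -val_eqE /= eq_sym; exact/eqP/orbit_eqP.
exists K; split=> //.
  move=> B C /andP[BC /existsP[x1 /andP[x1B /existsP[y1 /andP[y1C exy]]]]] x xB.
  have [x0 /eqP eB] := clP B; have [y0 /eqP eC] := clP C.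
  have : e' (phi x) (phi y1).
    have -> : phi x = phi x1; last exact: homo.
    by move: xB x1B; rewrite eB /= !orbE => /eqP<- /eqP.
  case/lift=> y exy' y1y; apply/eqP/cards1P; exists y.
  apply/setP=> z; rewrite !inE; apply/andP/eqP=> [[zC exz]|->].
    apply: (inj x) => //.
    by move: zC y1C; rewrite eC /= !orbE y1y => /eqP<- /eqP.
  by split=> //; move: y1C; rewrite eC /= !orbE y1y.
have sGN : G \subset 'N(K) by apply: normal_norm.
(* [K] is the kernel of [f], so [f] factors through an injective morphism on [G / K], whose image is
   [H]. *)
have kf : 'ker (coset K) \subset 'ker f by rewrite ker_coset.
exists F; exists [morphism of factm kf sGN].
have Finj : injective F.
  move=> B C; have [[x /eqP->] [y /eqP->]] := (clP B, clP C).
  by rewrite !FE => /eqP; rewrite -clE => /eqP.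
split.
- apply: inj_card_bij => //; rewrite -(card_imset _ Finj).
  apply/subset_leq_card/subsetP=> v _; apply/imsetP.
  by have [x <-] := surj v; exists (cl x).
- move=> B C; have [[x /eqP->] [y /eqP->]] := (clP B, clP C); rewrite !FE.
  apply/idP/andP=> [exy|[_]].
    split.
      by rewrite clE; apply: contraTneq exy => ->; rewrite irr'.
    have [y' exy' y'y] := lift _ _ exy.
    apply/existsP; exists x; rewrite /= orbit_refl /=.
    by apply/existsP; exists y'; rewrite exy' andbT orbE y'y.
  case/existsP=> x1 /andP[x1B /existsP[y1 /andP[y1C /homo]]].
  by move: x1B y1C; rewrite /= !orbE => /eqP-> /eqP->.
- apply/isomP; split; first by apply/injm_factmP; rewrite ker_coset.
  rewrite /= morphim_factm; apply/setP=> p.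
  apply/morphimP/idP=> [[g gG _ ->]|/HG[g gG gE]]; first by case: (indP g gG).
  by exists g => //; apply: eqV => x; rewrite gE (indP g gG).2.
- move=> B Kg /morphimP[g nKg gG ->]; have [x /eqP->] := clP B.
  rewrite FE.
  have -> : [morphism of factm kf sGN] (coset K g) = ind g by apply: factmE.
  rewrite /= apermE (indP g gG).2 -FE; congr F; apply: val_inj.
  rewrite quotient_actE //=; apply/setP=> y; rewrite orbE.
  apply/imsetP/eqP=> [[z]|gxy].
    rewrite orbE => /eqP xz ->.
    by rewrite -(indP g gG).2 xz (indP g gG).2.
  exists ((g^-1)%g y); last by rewrite permKV.
  rewrite orbE -(inj_eq (@perm_inj _ (ind g))) !(indP g gG).2 permKV.
  exact/eqP.
Qed.

End NormalCover.

(** * Arcs of an oriented graph *)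

Section Arcs.

Variables (T : finType) (e : rel T) (G : {group {perm T}}) (D : {set T * T}).
Hypothesis hOG : OG4 e G D.

Lemma adj_sym : symmetric e.
Proof. by case: (OG4_simple hOG). Qed.

Lemma adj_act g x y : g \in G -> e (g x) (g y) = e x y.
Proof.
move=> /(subsetP (OG4_aut hOG)); rewrite inE => /forallP/(_ x)/forallP/(_ y).
by move/eqP.
Qed.

Lemma vertex_trans x y : exists2 g : {perm T}, g \in G & g x = y.
Proof.
have [g gG ->] := atransP2 (OG4_vertex_transitive hOG) (in_setT x) (in_setT y).
by exists g.
Qed.

Lemma arc_adj x y : (x, y) \in D -> e x y.
Proof. by have [_ DE _] := OG4_orientation hOG; apply: DE. Qed.

Lemma adj_arc x y : e x y -> (x, y) \in D \/ (y, x) \in D.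
Proof.
have [_ _ DE] := OG4_orientation hOG => /DE.
by case: ((x, y) \in D); [left | right].
Qed.

Lemma arc_asym x y : (x, y) \in D -> (y, x) \in D -> False.
Proof.
have [_ _ DE] := OG4_orientation hOG => xy yx.
by have := DE _ _ (arc_adj xy); rewrite xy yx.
Qed.

Lemma arc_trans x y x' y' : (x, y) \in D -> (x', y') \in D ->
  exists g : {perm T}, [/\ g \in G, g x = x' & g y = y'].
Proof.
have [[a ->] _ _] := OG4_orientation hOG.
case/imsetP=> g gG [-> ->] /imsetP[h hG [-> ->]].
by exists (g^-1 * h); rewrite groupM ?groupV // !permM !permK.
Qed.

Lemma arc_act g x y : g \in G -> ((g x, g y) \in D) = ((x, y) \in D).
Proof.
have [[a ->] _ _] := OG4_orientation hOG.
suff imp h u v : h \in G ->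
    (u, v) \in [set ((k : {perm T}) a.1, k a.2) | k in G] ->
    (h u, h v) \in [set ((k : {perm T}) a.1, k a.2) | k in G].
  move=> gG; apply/idP/idP => [|]; last exact: imp.
  by move/(imp g^-1); rewrite !permK groupV; apply.
move=> hG /imsetP[k kG [-> ->]]; apply/imsetP; exists (k * h).
  exact: groupM.
by rewrite !permM.
Qed.

Lemma arc_exists : exists x y, (x, y) \in D.
Proof.
have [[a ->] _ _] := OG4_orientation hOG.
by exists a.1, a.2; apply/imsetP; exists 1 => //; rewrite !perm1.
Qed.

Lemma out_arc x : exists y, (x, y) \in D.
Proof.
have [u [v uv]] := arc_exists; have [g gG <-] := vertex_trans u x.
by exists (g v); rewrite arc_act.
Qed.

Lemma in_arc x : exists y, (y, x) \in D.
Proof.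
have [u [v uv]] := arc_exists; have [g gG <-] := vertex_trans v x.
by exists (g u); rewrite arc_act.
Qed.

Lemma vertex_ind (P : T -> Prop) (x0 : T) :
  P x0 -> (forall x y, e x y -> P x -> P y) -> forall x, P x.
Proof.
move=> P0 PS x; have /connectP[p ep ->] := OG4_connected hOG x0 x.
elim: p x0 P0 ep => //= y p IHp x0 P0 /andP[exy]; apply: IHp.
exact: PS exy P0.
Qed.

End Arcs.

(** Only the vertex-orbits enter a quotient graph, so [<[rho]>], perhaps not normal, can be
    exchanged for a normal subgroup with the same orbits. *)
Lemma quotient_is_cycle_orbits (T : finType) (e : rel T)
    (N L : {set {perm T}}) l :
  orbits L = orbits N -> quotient_is_cycle e N l -> quotient_is_cycle e L l.
Proof.
by rewrite /quotient_is_cycle /qadj /qvert => ->.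
Qed.

Lemma oriented_quotient_orbits (T : finType) (e : rel T) (D : {set T * T})
    (N L : {set {perm T}}) :
  orbits L = orbits N -> oriented_quotient e D N -> oriented_quotient e D L.
Proof.
by rewrite /oriented_quotient /qadj /qvert => ->.
Qed.

(** * Unit steps on a cycle *)

Definition sign p (d : 'Z_p) : bool := (d == 1%R) || (d == (- 1)%R).

Section Sign.
Local Open Scope ring_scope.
Variable p : nat.
Hypothesis p3 : (3 <= p)%N.
Implicit Types d : 'Z_p.

(** Keeps the two directions on a cycle apart and prevents an injective map from turning back. *)
Lemma two_neq0 : (1 + 1 != 0 :> 'Z_p).
Proof.
have p1 : (1 < p)%N by apply: leq_trans p3.
apply/eqP=> /(congr1 (@nat_of_ord _)) two0; have := val_Zp_nat p1 2.
by rewrite modn_small // -[2%:R]/(1 + 1 : 'Z_p) two0.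
Qed.

Lemma sign1 : sign (1 : 'Z_p). Proof. by rewrite /sign eqxx. Qed.

Lemma signP d : sign d -> d = 1 \/ d = -1.
Proof. by case/orP=> /eqP; [left | right]. Qed.

Lemma signN d : sign (- d) = sign d.
Proof. by rewrite /sign eqr_oppLR orbC eqr_opp. Qed.

Lemma signM d d' : sign d -> sign d' -> sign (d * d').
Proof.
by case/signP=> -> /signP[] ->; rewrite ?mulrNN ?mul1r ?mulr1 ?signN ?sign1.
Qed.

Lemma sign_sqr d : sign d -> d * d = 1.
Proof. by case/signP=> ->; rewrite ?mulrNN mulr1. Qed.

Lemma sign_neqN d : sign d -> d != - d.
Proof.
move=> sd; rewrite -subr_eq0 opprK.
by case/signP: sd => ->; rewrite -?opprD ?oppr_eq0 two_neq0.
Qed.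

Lemma sign_eq_or d d' : sign d -> sign d' -> d' = d \/ d' = - d.
Proof.
by case/signP=> -> /signP[] ->; rewrite ?opprK; auto.
Qed.

(** Two successive steps of opposite sign would give [h (i + 1 + 1) = h i], against injectivity. So
    all steps equal the first one, [h 1 - h 0]. *)
Lemma affine_of_steps (h : 'Z_p -> 'Z_p) :
  injective h -> (forall i, sign (h (i + 1) - h i)) ->
  exists2 d, sign d & forall i j, h i - h j = d * (i - j).
Proof.
move=> hinj hstep; pose d := h 1 - h 0; exists d.
  by have := hstep 0; rewrite add0r.
have hS i : h (i + 1) - h i = h (i + 1 + 1) - h (i + 1).
  have [->//|eqN] := sign_eq_or (hstep i) (hstep (i + 1)).
  have /hinj/eqP : h (i + 1 + 1) = h i.
    by rewrite -[LHS](subrK (h (i + 1))) eqN opprB subrK.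
  by rewrite -addrA -[X in _ == X]addr0 (inj_eq (addrI _)) (negPf two_neq0).
have hn n : h (n%:R + 1) - h n%:R = d.
  elim: n => [|n IHn]; first by rewrite add0r.
  by rewrite -natr1 -hS.
have h0 n : h n%:R = h 0 + d * n%:R.
  elim: n => [|n IHn]; first by rewrite mulr0 addr0.
  by rewrite -natr1 mulrDr mulr1 addrA -IHn -(hn n) addrC subrK.
move=> i j; rewrite -(natr_Zp i) -(natr_Zp j) !h0; ring.
Qed.

End Sign.

(** * Coordinates on cyclic quotients *)

Section Coordinate.

Variables (T : finType) (e : rel T) (G : {group {perm T}}) (D : {set T * T}).
Hypothesis hOG : OG4 e G D.

(** Encodes a quotient isomorphic to a cycle by the positions of the vertices on it. Of the normal
    subgroup two traces remain: [G] permutes the fibres, and the elements of [G] that keep all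
    positions are transitive on each fibre. *)
Record cyclic_coord p (a : T -> 'Z_p) : Prop := CyclicCoord {
  coord_step : forall x y, e x y -> sign (a y - a x)%R;
  coord_nbr : forall x d, sign d -> exists2 y, e x y & a y = (a x + d)%R;
  coord_fiber : forall x y, a x = a y ->
    exists g : {perm T}, [/\ g \in G, forall z, a (g z) = a z & g x = y];
  coord_act : forall g x y, g \in G -> a x = a y -> a (g x) = a (g y)
}.

Definition oriented_coord p (a : T -> 'Z_p) : Prop :=
  forall x y x' y', e x y -> e x' y' -> a x = a x' -> a y = a y' ->
    ((x, y) \in D) = ((x', y') \in D).

Lemma cycle_adjE p (i j : 'Z_p) : cycle_adj i j = sign (j - i)%R.
Proof. by rewrite /cycle_adj /sign !subr_eq ![(_ + i)%R]addrC. Qed.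

Lemma cyclic_coord_of_quotient (N : {group {perm T}}) p :
    N <| G -> 3 <= p -> quotient_is_cycle e N p ->
  exists a : T -> 'Z_p,
    cyclic_coord a /\ (oriented_quotient e D N <-> oriented_coord a).
Proof.
move=> nNG p3 [f [[f' fK f'K] fE]].
have NG : N \subset G by apply: normal_sub.
pose a x := f (qclass N x); exists a.
have aE x y : (a x == a y) = (y \in orbit 'P N x).
  rewrite (can_eq fK) -val_eqE /= eq_sym; apply/eqP/idP => [<-|].
    exact: orbit_refl.
  by move/orbit_eqP.
have actN g x : g \in N -> a (g x) = a x.
  by move=> gN; apply/esym/eqP; rewrite aE; apply/imsetP; exists g.
have orbP x y : a x = a y -> exists2 g : {perm T}, g \in N & g x = y.
  by move/eqP; rewrite aE => /imsetP[g gN ->]; exists g.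
have aact g x y : g \in G -> a x = a y -> a (g x) = a (g y).
  (* Normality enters here: an element of [N] moved past [g] becomes its conjugate, again in [N]. *)
  move=> gG /orbP[h hN <-].
  have -> : g (h x) = (h ^ g)%g (g x) by rewrite conjgE !permM permK.
  by apply/esym/actN; rewrite memJ_norm // (subsetP (normal_norm nNG)).
have adjP x y : qadj e (qclass N x) (qclass N y) ->
    exists x' y', [/\ a x = a x', a y = a y' & e x' y'].
  case/andP=> _ /existsP[x' /andP[xx' /existsP[y' /andP[yy' exy]]]].
  by exists x', y'; split=> //; apply/eqP; rewrite aE.
(* The cycle has the edge from 0 to 1, so some arc joins distinct orbits; arc-transitivity of [G]
   then excludes edges inside an orbit. *)
have crossing x y : e x y -> a x != a y.
  have [u [v [uv euv]]] : exists u v, a u != a v /\ e u v.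
    have [u0 /eqP u0E] := qclassP (f' 0%R).
    have [v0 /eqP v0E] := qclassP (f' 1%R).
    have [|u [v [uE vE euv]]] := adjP u0 v0.
      by rewrite -u0E -v0E -fE !f'K cycle_adjE subr0 sign1.
    exists u, v; split=> //; rewrite -uE -vE /a -u0E -v0E !f'K.
    by rewrite eq_sym oner_eq0.
  have arcP u1 v1 : (u1, v1) \in D -> a u1 != a v1.
    have {u v uv euv}[u [v [uv Duv]]] : exists u v, a u != a v /\ (u, v) \in D.
      have [Duv|Dvu] := adj_arc hOG euv; first by exists u, v.
      by exists v, u; rewrite eq_sym.
    move=> D1; have [g [gG gu gv]] := arc_trans hOG D1 Duv.
    by apply: contra uv => /eqP/(aact _ _ _ gG); rewrite gu gv => ->.
  by case/(adj_arc hOG)=> /arcP //; rewrite eq_sym.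
have adjE x y : e x y -> qadj e (qclass N x) (qclass N y).
  move=> exy; rewrite /qadj; apply/andP; split.
    by apply: contra (crossing _ _ exy) => /eqP xy; rewrite /a xy.
  apply/existsP; exists x; rewrite /= orbit_refl; apply/existsP; exists y.
  by rewrite orbit_refl.
split; first split=> //.
- by move=> x y /adjE; rewrite -fE cycle_adjE.
(* Some edge joins the two adjacent orbits; an element of [N] moves its first end to [x]. *)
- move=> x d sd; have [z /eqP zE] := qclassP (f' (a x + d)%R).
  have [|x1 [y1 [xx1 zy1 exy]]] := adjP x z.
    by rewrite -fE -zE f'K cycle_adjE addrC addKr.
  have [g gN <-] := orbP _ _ (esym xx1); exists (g y1).
    by rewrite (adj_act hOG) // (subsetP NG).
  by rewrite actN // -zy1 [LHS]/a -zE f'K xx1 actN.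
- move=> x y /orbP[g gN gx]; exists g; split=> // [|z]; last exact: actN.
  exact: (subsetP NG).
split=> [ori x y x' y' exy exy' xx' yy'|ori B C _ x x' y y'].
  apply: (ori _ _ (adjE _ _ exy)); split=> //=; rewrite ?orbit_refl //.
    by rewrite -aE xx'.
  by rewrite -aE yy'.
have [[u /eqP->] [v /eqP->]] := (qclassP B, qclassP C).
rewrite /= -!aE => -[/eqP ux /eqP vy exy] [/eqP ux' /eqP vy' exy'].
by apply: ori; rewrite // -?ux -?vy.
Qed.

End Coordinate.

(** * Action of the group on cyclic coordinates *)

Section CoordTheory.
Local Open Scope ring_scope.

Variables (T : finType) (e : rel T) (G : {group {perm T}}) (D : {set T * T}).
Hypothesis hOG : OG4 e G D.
Variable p : nat.
Hypothesis p3 : (3 <= p)%N.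
Implicit Type a : T -> 'Z_p.

Lemma coord_surj a : cyclic_coord e G a -> forall i, exists x, a x = i.
Proof.
move=> ca i; have [x0 _] := arc_exists hOG.
suff [x ax] : exists x, a x = a x0 + (i - a x0)%R%:R.
  by exists x; rewrite ax natr_Zp addrC subrK.
elim: (nat_of_ord _) => [|n [x ax]]; first by exists x0; rewrite addr0.
have [y _ ay] := coord_nbr ca x (sign1 p); exists y.
by rewrite ay ax -natr1 addrA.
Qed.

(** Both [g] and its inverse preserve equality of positions, so [g] induces an injective map of the
    cycle. It carries edges to edges, hence has unit steps, and [affine_of_steps] applies. *)
Lemma coord_sign a g : cyclic_coord e G a -> g \in G ->
  exists2 d, sign d & forall x y, a (g x) - a (g y) = d * (a x - a y).
Proof.
move=> ca gG.
have [t at_] : exists t, forall i, a (t i) = i.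
  have /fin_all_exists[t tE] := coord_surj ca.
  by exists t.
have aN x y : a (g x) = a (g y) -> a x = a y.
  by move/(coord_act ca (groupVr gG)); rewrite !permK.
have tE x : a (g (t (a x))) = a (g x) by apply: (coord_act ca gG); rewrite at_.
have [d sd dE] : exists2 d, sign d &
    forall i j, a (g (t i)) - a (g (t j)) = d * (i - j).
  apply: (affine_of_steps p3 (h := fun i => a (g (t i)))) => [i j /aN|i].
    by rewrite !at_.
  have [y exy ay] := coord_nbr ca (t i) (sign1 p).
  have <- : a y = i + 1 by rewrite ay at_.
  by rewrite tE (coord_step ca) // (adj_act hOG).
by exists d => // x y; rewrite -(tE x) -(tE y) dE.
Qed.

Lemma coordN a :
  cyclic_coord e G a -> cyclic_coord e G (p := p) (fun x => - a x).
Proof.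
move=> ca; split=> [x y exy|x d sd|x y /oppr_inj/(coord_fiber ca)|g x y gG].
- by rewrite -opprD signN (coord_step ca).
- have [|y exy ay] := coord_nbr ca x (d := - d); first by rewrite signN.
  by exists y; rewrite // ay opprD opprK.
- by case=> g [gG gE gx]; exists g; split=> // z; rewrite gE.
by move/oppr_inj/(coord_act ca gG) => ->.
Qed.

(** After an arc with step [d], no arc steps back, since it would run parallel to the reverse of the
    first. A directed walk therefore meets every position with step [d], and an arc with step [- d]
    would oppose an arc of this walk. If [d = -1], negating [a] gives the required coordinate. *)
Lemma oriented_coord_arcs a : cyclic_coord e G a -> oriented_coord e D a ->
  exists2 a' : T -> 'Z_p, cyclic_coord e G a' &
    forall x y, (x, y) \in D -> a' y = a' x + 1.
Proof.
move=> ca ori; have [x0 [y0 D0]] := arc_exists hOG.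
have [d sd arcE] : exists2 d, sign d &
    forall x y, (x, y) \in D -> a y = a x + d.
  pose d := a y0 - a x0.
  have sd : sign d := coord_step ca (arc_adj hOG D0).
  exists d => //.
  have up x y : (x, y) \in D -> a y = a x + d ->
      forall z, (y, z) \in D -> a z = a y + d.
    move=> xy yE z yz; apply/eqP; rewrite addrC -subr_eq; apply/eqP.
    have syz := coord_step ca (arc_adj hOG yz).
    have [//|zN] := sign_eq_or sd syz.
    have zx : a z = a x by rewrite -[LHS](subrK (a y)) zN yE addrC addrK.
    have eyx : e y x by rewrite (adj_sym hOG) (arc_adj hOG).
    have := ori y z y x (arc_adj hOG yz) eyx erefl zx.
    by rewrite yz => /esym /(arc_asym hOG xy).
  have level i : exists x y, [/\ (x, y) \in D, a x = i & a y = a x + d].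
    (* Following the walk for [d * (i - a x0)] further arcs leads to an arc starting at position
       [i], because [d * d = 1]. *)
    suff [x [y [xy ax ay]]] : exists x y,
        [/\ (x, y) \in D, a x = a x0 + d * (d * (i - a x0))%R%:R
          & a y = a x + d].
      exists x, y; split=> //.
      by rewrite ax natr_Zp mulrA sign_sqr // mul1r addrC subrK.
    elim: (nat_of_ord _) => [|n [x [y [xy ax ay]]]].
      by exists x0, y0; split; rewrite ?mulr0 ?addr0 // addrC subrK.
    have [z yz] := out_arc hOG y; exists y, z.
    split=> //; last exact: up xy ay _ yz.
    by rewrite ay ax -natr1; ring.
  move=> x y xy; have sxy := coord_step ca (arc_adj hOG xy).
  apply/eqP; rewrite addrC -subr_eq; apply/eqP.
  have [//|yN] := sign_eq_or sd sxy.
  have [u [v [uv au av]]] := level (a y).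
  have vx : a v = a x by rewrite av au -[a y](subrK (a x)) yN addrC addNKr.
  have eyx : e y x by rewrite (adj_sym hOG) (arc_adj hOG).
  have := ori u v y x (arc_adj hOG uv) eyx au vx.
  by rewrite uv => /esym /(arc_asym hOG xy).
have [dE|dE] := signP sd; rewrite dE in arcE; first by exists a.
exists (fun x => - a x : 'Z_p); first exact: coordN.
by move=> x y /arcE->; rewrite opprD opprK.
Qed.

(** Arcs go to arcs, so [g] keeps the difference of [a] along every edge; connectedness extends this
    to all pairs. *)
Lemma arc_coord_act a g : (forall x y, (x, y) \in D -> a y = a x + 1) ->
  g \in G -> forall x y, a (g x) - a (g y) = a x - a y.
Proof.
move=> arcE gG x y; move: x.
apply: (vertex_ind hOG (x0 := y)) => [|u v euv IH].
  by rewrite !subrr.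
have [uv|vu] := adj_arc hOG euv.
  have /arcE-> : (g u, g v) \in D by rewrite (arc_act hOG).
  by rewrite (arcE _ _ uv) addrAC IH addrAC.
have /arcE guE : (g v, g u) \in D by rewrite (arc_act hOG).
by apply: (addIr 1); rewrite addrAC [RHS]addrAC -guE -(arcE _ _ vu).
Qed.

(* If [g] fixes [x] and moves an out-neighbour (or an in-neighbour) of [x] at
   relative position [d] to one at [- d], it reverses the cycle. When no
   such [g] exists, the out-neighbours of each vertex all lie on one side and
   the in-neighbours on the other, so the quotient is oriented. *)
Lemma reverser a : cyclic_coord e G a -> ~ oriented_coord e D a ->
  exists x (g : {perm T}),
    [/\ g \in G, g x = x & forall y, a (g y) - a x = - (a y - a x)].
Proof.
move=> ca Nori.
(* Over finite types the claim is a boolean, so the contrapositive can be proved instead. *)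
suff : [exists x, [exists g : {perm T} in G,
    (g x == x) && [forall y, a (g y) - a x == - (a y - a x)]]].
  case/existsP=> x /existsP[g /and3P[gG /eqP gx /forallP gE]].
  by exists x, g; split=> // y; apply/eqP.
apply: contra_notT Nori => Nrev.
(* A single neighbour sent to the opposite side forces the sign of [g] to be [-1], and [g] then
   reverses every position around [x]. *)
have norev x y z g : g \in G -> g x = x -> g y = z -> e x y ->
    a z - a x = - (a y - a x) -> False.
  move=> gG gx gy exy azN; have [d sd dE] := coord_sign ca gG.
  have sy := coord_step ca exy; case/negP: Nrev.
  have dN1 : d = - 1.
    have := dE y x; rewrite gy gx azN => /(congr1 ( *%R^~ (a y - a x))).
    by rewrite mulNr -mulrA sign_sqr // mulr1.
  apply/existsP; exists x; apply/existsP; exists g; rewrite gG gx eqxx /=.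
  by apply/forallP=> w; have := dE w x; rewrite gx dN1 mulN1r => ->.
(* Two parallel edges with opposite directions: after moving [x'] to [x], the vertex [x] has an
   out-neighbour and an in-neighbour on the same side. Any neighbour [w] on the other side is the
   image of one of them under an element fixing [x]. *)
have key x y x' y' : e x y -> e x' y' -> a x = a x' -> a y = a y' ->
    (x, y) \in D -> (y', x') \in D -> False.
  move=> exy exy' ax ay xy yx'.
  have [h [hG hE hx]] := coord_fiber ca (esym ax).
  have yx : (h y', x) \in D by rewrite -hx (arc_act hOG).
  have sy := coord_step ca exy.
  have [|w exw aw] := coord_nbr ca x (d := - (a y - a x)).
    by rewrite signN.
  have awx : a w - a x = - (a y - a x) by rewrite aw addrC addKr.
  have [xw|wx] := adj_arc hOG exw.
    by have [g [gG gx gy]] := arc_trans hOG xy xw; apply: (norev x y w g).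
  have [g [gG gy gx]] := arc_trans hOG yx wx.
  apply: (norev x (h y') w g) => //; last by rewrite hE -ay.
  by rewrite (adj_sym hOG) (arc_adj hOG).
move=> x y x' y' exy exy' ax ay; apply/idP/idP=> [xy|xy].
  by have [//|yx] := adj_arc hOG exy'; case: (key x y x' y').
have [//|yx] := adj_arc hOG exy.
by case: (key x' y' x y); rewrite // -?ax -?ay.
Qed.

(** Pass from [x] to [y] through the vertex [x0] fixed by a reverser; inserting the reverser there
    or not realises the two signs. *)
Lemma signed_trans a : cyclic_coord e G a -> ~ oriented_coord e D a ->
  forall x y d, sign d -> exists g : {perm T},
    [/\ g \in G, g x = y & forall z, a (g z) - a y = d * (a z - a x)].
Proof.
move=> ca Nori x y d sd; have [x0 [h [hG hx hE]]] := reverser ca Nori.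
have [k kG kx] := vertex_trans hOG x x0.
have [l lG ly] := vertex_trans hOG x0 y.
have [dk sk dkE] := coord_sign ca kG; have [dl sl dlE] := coord_sign ca lG.
have [->|->] := sign_eq_or (signM sl sk) sd.
  exists (k * l)%g; split; rewrite ?groupM ?permM ?kx //.
  by move=> z; rewrite permM -ly -kx dlE dkE mulrA.
exists (k * h * l)%g; split; rewrite ?groupM ?permM ?kx ?hx //.
move=> z; rewrite !permM -ly dlE hE -kx dkE; ring.
Qed.

End CoordTheory.

Lemma std_adjE r s (p q : stdX r s) :
  std_adj p q = sign (q.1 - p.1)%R && sign (q.2 - p.2)%R.
Proof.
by rewrite /std_adj /sign !subr_eq ![(_ + p.1)%R]addrC ![(_ + p.2)%R]addrC.
Qed.

Lemma std_arcsE r s (p q : stdX r s) :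
  ((p, q) \in std_arcs r s) = sign (q.1 - p.1)%R && (q.2 == p.2 + 1)%R.
Proof. by rewrite inE /sign !subr_eq /= ![(_ + p.1)%R]addrC. Qed.

Lemma subrDr (R : zmodType) (x y z : R) : (x + z - (y + z) = x - y)%R.
Proof. by rewrite opprD addrACA subrr addr0. Qed.

(** * Affine groups on the standard graphs *)

Section Model.
Local Open Scope ring_scope.

(* [io] is the identity for Gamma(r, s) and the inclusion of X^+ for
   Gamma^+(r, s). *)
Variables (r s : nat) (V : finType) (io : V -> stdX r s).

Definition affine (p : {perm V}) : Prop :=
  exists d c c', sign d /\
    forall u, io (p u) = (d * (io u).1 + c, (io u).2 + c').

Definition model_adj : rel V := fun u v => std_adj (io u) (io v).

Definition model_arcs : {set V * V} :=
  [set a | (io a.1, io a.2) \in std_arcs r s].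

Lemma affine_group_gen (A : {set {perm V}}) :
  (forall p, p \in A -> affine p) -> forall p, p \in <<A>>%g -> affine p.
Proof.
move=> affA p /gen_prodgP[n [c cA ->]].
elim: n c cA => [|n IHn] c cA.
  rewrite big_ord0; exists 1, 0, 0; split; first exact: sign1.
  by move=> u; rewrite perm1 mul1r !addr0; case: (io u).
rewrite big_ord_recr /=.
have [//|d [t [t' [sd dE]]]] := IHn (fun i => c (widen_ord (leqnSn n) i)).
have [d1 [t1 [t1' [sd1 d1E]]]] := affA _ (cA ord_max).
exists (d1 * d), (d1 * t + t1), (t' + t1'); split; first exact: signM.
by move=> u; rewrite permM d1E dE /=; congr pair; ring.
Qed.

(** Collects what the two standard graphs share, so that one argument serves both. [model_homo] says
    that the affine map of sign [d] taking [u] to [v] preserves the vertex set; [model_closed] and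
    [model_connected] make this set a connected component of the full graph. *)
Record std_model (H : {group {perm V}}) : Prop := StdModel {
  model_inj : injective io;
  model_point : inhabited V;
  model_homo : forall u v w d, sign d ->
    exists z, io z = (d * ((io w).1 - (io u).1) + (io v).1,
                      (io w).2 - (io u).2 + (io v).2);
  model_closed : forall u q, std_adj (io u) q -> exists v, io v = q;
  model_connected : forall u v, connect model_adj u v;
  model_group : forall p, p \in H <-> affine p
}.

Variable H : {group {perm V}}.
Hypotheses (r3 : (3 <= r)%N) (s3 : (3 <= s)%N) (hH : std_model H).

(** The values given by [model_homo] form an injective map because [d * d = 1]; being affine, it
    lies in [H] by [model_group]. *)
Lemma model_perm u v d : sign d -> exists p : {perm V},
  [/\ p \in H, p u = v &
      forall w, io (p w) = (d * ((io w).1 - (io u).1) + (io v).1,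
                            (io w).2 - (io u).2 + (io v).2)].
Proof.
move=> sd.
have [f fE] : exists f : V -> V, forall w,
    io (f w) = (d * ((io w).1 - (io u).1) + (io v).1,
                (io w).2 - (io u).2 + (io v).2).
  have /fin_all_exists[f fE] := fun w => model_homo hH u v w sd.
  by exists f.
have finj : injective f.
  move=> w w' /(congr1 io); rewrite !fE => /pair_equal_spec[].
  move=> /addIr/(congr1 ( *%R d)).
  rewrite !mulrA sign_sqr // !mul1r => /addIr E1.
  move=> /addIr/addIr E2; apply: (model_inj hH).
  by rewrite (surjective_pairing (io w)) E1 E2 -surjective_pairing.
exists (perm finj); split=> [||w]; last by rewrite permE.
  apply/(model_group hH).
  exists d, ((io v).1 - d * (io u).1), ((io v).2 - (io u).2).
  by split=> // w; rewrite permE fE; congr pair; ring.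
apply: (model_inj hH); rewrite permE fE !subrr mulr0 !add0r.
by case: (io v).
Qed.

Lemma model_arc_trans u u' v v' :
    (u, u') \in model_arcs -> (v, v') \in model_arcs ->
  exists p : {perm V}, [/\ p \in H, p u = v & p u' = v'].
Proof.
rewrite inE [in (v, v') \in _]inE !std_arcsE.
move=> /andP[su /eqP u2] /andP[sv /eqP v2].
(* Multiplying by the product of the two horizontal steps turns the first step into the second,
   since signs square to 1. *)
have [p [pH pu pE]] := model_perm u v (signM su sv).
exists p; split=> //; apply: (model_inj hH); rewrite pE u2.
rewrite [RHS]surjective_pairing v2; congr pair; last by ring.
by rewrite mulrAC sign_sqr // mul1r subrK.
Qed.

Lemma model_adjC u v : model_adj u v = model_adj v u.
Proof.
by rewrite /model_adj !std_adjE -signN opprB -[sign (_.2 - _)]signN opprB.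
Qed.

Lemma model_arcE u v :
  ((u, v) \in model_arcs) =
    sign ((io v).1 - (io u).1) && ((io v).2 == (io u).2 + 1).
Proof. by rewrite inE std_arcsE. Qed.

Lemma model_adjE u v :
  model_adj u v = ((u, v) \in model_arcs) || ((v, u) \in model_arcs).
Proof.
rewrite !model_arcE /model_adj std_adjE.
rewrite -[sign ((io u).1 - _)]signN opprB -andb_orr; congr andb.
rewrite /sign !subr_eq [1 + _]addrC [- 1 + _]addrC; congr orb.
by rewrite eq_sym subr_eq.
Qed.

Lemma model_arc_asym u v :
  (u, v) \in model_arcs -> (v, u) \in model_arcs -> False.
Proof.
rewrite !model_arcE => /andP[_ /eqP->] /andP[_].
by rewrite -addrA -[X in X == _]addr0 (inj_eq (addrI _)) eq_sym
           (negPf (two_neq0 s3)).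
Qed.

Lemma model_act p u v : p \in H -> model_adj (p u) (p v) = model_adj u v.
Proof.
case/(model_group hH)=> d [c [c' [sd pE]]]; rewrite /model_adj !std_adjE !pE /=.
rewrite !subrDr -mulrBr.
by have [->|->] := signP sd; rewrite ?mul1r // mulN1r signN.
Qed.

Lemma model_arc_act p u v :
  p \in H -> ((p u, p v) \in model_arcs) = ((u, v) \in model_arcs).
Proof.
case/(model_group hH)=> d [c [c' [sd pE]]]; rewrite !model_arcE !pE /=.
rewrite [_ + c' + 1]addrAC -subr_eq addrK subrDr -mulrBr.
by have [->|->] := signP sd; rewrite ?mul1r // mulN1r signN.
Qed.

Lemma card_model_adj u : #|[set v | model_adj u v]| = 4%N.
Proof.
rewrite -(card_imset _ (model_inj hH)).
have -> : [set io v | v in [set v | model_adj u v]] =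
    setX [set (io u).1 + 1; (io u).1 - 1] [set (io u).2 + 1; (io u).2 - 1].
  apply/setP=> q; transitivity (std_adj (io u) q); last by rewrite !inE.
  apply/imsetP/idP=> [[v]|qu]; first by rewrite inE => uv ->.
  by have [v vq] := model_closed hH qu; exists v; rewrite // inE /model_adj vq.
by rewrite cardsX !cards2 !(inj_eq (addrI _)) !sign_neqN ?sign1.
Qed.

Lemma model_arc0 : exists u v, (u, v) \in model_arcs.
Proof.
have [u] := model_point hH.
have [|v vE] := model_closed hH (u := u) (q := ((io u).1 + 1, (io u).2 + 1)).
  by rewrite std_adjE /= !(addrC _ 1) !addrK !sign1.
exists u, v; rewrite model_arcE vE /= eqxx andbT.
by rewrite addrC addKr sign1.
Qed.

Lemma model_OG4 : OG4 model_adj H model_arcs.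
Proof.
have [u0] := model_point hH; have [v0 [w0 vw0]] := model_arc0.
have HS : H \subset graph_aut model_adj.
  apply/subsetP=> p pH; rewrite inE; apply/forallP=> u; apply/forallP=> v.
  by rewrite model_act.
split=> //.
- split; first exact: model_adjC.
  move=> u; rewrite model_adjE orbb; apply/negP=> arc_uu.
  exact: (model_arc_asym arc_uu arc_uu).
- exact: model_connected hH.
- exact: card_model_adj.
- apply/imsetP; exists u0; rewrite // -/(orbit _ _ _); apply/setP=> v.
  rewrite inE; have [p [pH <- _]] := model_perm u0 v (sign1 r).
  exact/esym/mem_orbit.
- apply/imsetP; exists [set v0; w0].
    by apply/imsetP; exists (v0, w0); rewrite // inE /= model_adjE vw0.
  apply/setP=> E; apply/imsetP/imsetP=> [[[u v]]|[p pH ->]].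
    rewrite inE /= => uv ->.
    wlog uvA: u v uv / (u, v) \in model_arcs.
      move=> IH; have := uv; rewrite model_adjE => /orP[|vu]; first exact: IH.
      by rewrite setUC; apply: IH; rewrite // model_adjC.
    have [p [pH <- <-]] := model_arc_trans vw0 uvA; exists p => //=.
    by rewrite /setact imsetU1 imset_set1.
  exists (p v0, p w0); first by rewrite inE /= model_act // model_adjE vw0.
  by rewrite /= /setact imsetU1 imset_set1.
split.
- exists (v0, w0); apply/setP=> -[u v]; apply/idP/imsetP=> [uv|[p pH [-> ->]]].
    by have [p [pH <- <-]] := model_arc_trans vw0 uv; exists p.
  by rewrite model_arc_act.
- by move=> u v uv; rewrite model_adjE uv.
move=> u v; rewrite model_adjE; have := @model_arc_asym u v.
by case: (_ \in _); case: (_ \in _) => // /(_ isT isT).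
Qed.

(** * Covering a standard model by a pair of coordinates *)

Section Cover.

Variables (T : finType) (e : rel T) (G : {group {perm T}}) (D : {set T * T}).
Variables (a : T -> 'Z_r) (b : T -> 'Z_s) (phi : T -> V).
Hypothesis hOG : OG4 e G D.
Hypotheses (ca : cyclic_coord e G a) (cb : cyclic_coord e G b).
Hypotheses (Nori : ~ oriented_coord e D a).
Hypotheses (arcb : forall x y, (x, y) \in D -> b y = b x + 1).
Hypothesis phiE : forall x, io (phi x) = (a x, b x).

Lemma phi_adj x y : e x y -> model_adj (phi x) (phi y).
Proof.
move=> exy; rewrite /model_adj std_adjE !phiE /=.
by rewrite (coord_step ca) // (coord_step cb).
Qed.

Lemma phi_eq x y : (phi x == phi y) = (a x == a y) && (b x == b y).
Proof. by rewrite -(inj_eq (model_inj hH)) !phiE. Qed.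

Lemma signed_trans2 x y d : sign d -> exists g : {perm T},
  [/\ g \in G, g x = y &
      forall z, a (g z) - a y = d * (a z - a x) /\ b (g z) - b y = b z - b x].
Proof.
move=> sd; have [g [gG gx gE]] := signed_trans hOG r3 ca Nori x y sd.
exists g; split=> // z; split=> //.
by rewrite -gx (arc_coord_act hOG arcb).
Qed.

(** An out-neighbour or in-neighbour of [x] already has the wanted step in [b]. An element of [G]
    fixing [x], with sign the product of the wanted and actual steps in [a], corrects [a] and leaves
    [b] unchanged. *)
Lemma phi_lift x v : model_adj (phi x) v -> exists2 y, e x y & phi y = v.
Proof.
rewrite /model_adj std_adjE phiE /= => /andP[sa sb].
suff [y exy [ya yb]] : exists2 y, e x y &
    a y - a x = (io v).1 - a x /\ b y - b x = (io v).2 - b x.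
  exists y => //; apply: (model_inj hH); rewrite phiE [RHS]surjective_pairing.
  by rewrite -[a y](subrK (a x)) -[b y](subrK (b x)) ya yb !subrK.
have [y exy yb] : exists2 y, e x y & b y - b x = (io v).2 - b x.
  have [->|->] := signP sb.
    have [y xy] := out_arc hOG x; exists y; first exact: (arc_adj hOG xy).
    by rewrite (arcb xy) addrC addKr.
  have [y yx] := in_arc hOG x; exists y.
    by rewrite (adj_sym hOG) (arc_adj hOG).
  by rewrite (arcb yx) opprD addrA subrr add0r.
have sy := coord_step ca exy.
have [g [gG gx gE]] := signed_trans2 x x (signM sa sy).
exists (g y); first by rewrite -{1}gx (adj_act hOG).
have [-> ->] := gE y; split=> //.
by rewrite -mulrA sign_sqr // mulr1.
Qed.

(** By lifting, [phi] maps the four neighbours of [x] onto the four neighbours of [phi x], hence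
    injectively. *)
Lemma phi_inj x y z : e x y -> e x z -> phi y = phi z -> y = z.
Proof.
move=> exy exz.
suff: {in [set y | e x y] &, injective phi} by apply; rewrite inE.
apply/imset_injP; rewrite (OG4_valency hOG) -(card_model_adj (phi x)).
rewrite eqn_leq; apply/andP; split; last first.
  apply/subset_leq_card/subsetP=> v; rewrite inE => /phi_lift[w exw <-].
  by apply: imset_f; rewrite inE.
by rewrite card_model_adj -(OG4_valency hOG x) leq_imset_card.
Qed.

(** By lifting, the image is closed under adjacency, and the model is connected. *)
Lemma phi_surj v : exists x, phi x = v.
Proof.
have [x0 _] := arc_exists hOG.
move: v.
apply: (vertex_ind model_OG4 (x0 := phi x0)) => [|u v uv [x xu]].
  by exists x0.
by move: uv; rewrite -xu => /phi_lift[y _ <-]; exists y.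
Qed.

Lemma model_normal_cover : normal_cover e model_adj G H.
Proof.
apply: (normal_cover_of_map (phi := phi)).
- by case: (OG4_simple model_OG4).
- exact: phi_surj.
(* The induced permutation is the affine one with the sign of [g] on [a] that takes [phi x0] to
   [phi (g x0)]. *)
- move=> g gG; have [x0 _] := arc_exists hOG.
  have [d sd dE] := coord_sign hOG r3 ca gG.
  have bE := arc_coord_act hOG arcb gG.
  have [p [pH px pE]] := model_perm (phi x0) (phi (g x0)) sd.
  exists p => // x; apply: (model_inj hH); rewrite pE !phiE /=.
  by rewrite -dE -(bE x x0) !subrK.
(* Conversely, [p] is realised by an element of [G] with the same sign taking [x0] to a vertex over
   [p (phi x0)]. *)
- move=> p /(model_group hH)[d [c [c' [sd pE]]]].
  have [x0 _] := arc_exists hOG; have [y yE] := phi_surj (p (phi x0)).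
  have [g [gG gx gE]] := signed_trans2 x0 y sd; exists g => // x.
  have := pE (phi x0); rewrite -yE !phiE => /pair_equal_spec[/= ya yb].
  apply: (model_inj hH); rewrite pE !phiE /=; have [ga gb] := gE x.
  rewrite -[a (g x)](subrK (a y)) -[b (g x)](subrK (b y)) ga gb ya yb.
  by congr pair; ring.
(* An element of sign 1 translates both coordinates, and here by 0 because [x] and [y] have equal
   positions. *)
- move=> x y xy; have [g [gG gx gE]] := signed_trans2 x y (sign1 r).
  exists g; split=> // z; apply/eqP; rewrite phi_eq; have [ga gb] := gE z.
  move/eqP: xy; rewrite phi_eq => /andP[/eqP xya /eqP xyb].
  move: ga gb; rewrite mul1r xya xyb => /addIr-> /addIr->.
  by rewrite !eqxx.
- exact: phi_adj.
- exact: phi_lift.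
exact: phi_inj.
Qed.

End Cover.

End Model.

(** * Weak metacirculants from a level function *)

Section WeakMetacirculant.

Variables (V : finType) (e : rel V) (s n : nat) (pi : V -> 'Z_s).
Variables rho lambda : {perm V}.
Hypotheses (s1 : 1 < s) (V0 : inhabited V).
Hypotheses (rhoA : rho \in graph_aut e) (lambdaA : lambda \in graph_aut e).
Hypothesis cardV : #|V| = (s * n)%N.
Hypothesis porbitE : forall u v, (v \in porbit rho u) = (pi u == pi v).
Hypothesis piS : forall u, pi (lambda u) = (pi u + 1)%R.
Hypothesis rhoC : commute rho lambda.

(** The cycles of [rho] are the levels of [pi], and powers of [lambda] carry any level to any other.
    So the [s] cycles have equal size, and counting vertices gives [n]. As [rho] and [lambda]
    commute, the exponent [k] is 1. *)
Lemma weak_metacirculant_levels : weak_metacirculant s n e rho lambda.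
Proof.
have piX k u : pi ((lambda ^+ k) u) = (pi u + k%:R)%R.
  elim: k => [|k IHk]; first by rewrite perm1 addr0.
  by rewrite expgSr permM piS IHk -addrA natr1.
have porbit_eq u v : pi u = pi v -> porbit rho u = porbit rho v.
  by move=> uv; apply/setP=> w; rewrite !porbitE uv.
have imX k u : (lambda ^+ k) @: porbit rho u = porbit rho ((lambda ^+ k) u).
  apply/setP=> v; rewrite porbitE piX; apply/imsetP/eqP=> [[w]|uv].
    by rewrite porbitE => /eqP-> ->; rewrite piX.
  exists ((lambda ^+ k)^-1 v); last by rewrite permKV.
  rewrite porbitE; apply/eqP/(addIr k%:R%R).
  by rewrite uv -piX permKV.
have reach u v : exists k, pi ((lambda ^+ k) u) = pi v.
  by exists (pi v - pi u)%R; rewrite piX natr_Zp addrC subrK.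
have [u0] := V0.
have cardp u : #|porbit rho u| = #|porbit rho u0|.
  have [k ku] := reach u0 u; rewrite -(porbit_eq _ _ ku) -imX.
  by rewrite card_imset //; apply: perm_inj.
have card_porbits : #|porbits rho| = s.
  pose t i := (lambda ^+ (i - pi u0)%R) u0.
  have tE i : pi (t i) = i by rewrite piX natr_Zp addrC subrK.
  have -> : porbits rho = [set porbit rho (t i) | i : 'Z_s].
    apply/setP=> A; apply/imsetP/imsetP=> -[u _ ->]; last by exists (t u).
    by exists (pi u) => //; apply: porbit_eq; rewrite tE.
  rewrite card_imset ?card_ord ?Zp_cast // => i j ij.
  by have := porbit_id rho (t i); rewrite ij porbitE !tE => /eqP.
split=> //.
- split=> // u; rewrite cardp.
  have cardP : {in porbits rho, forall A : {set V}, #|A| = #|porbit rho u0|}.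
    by move=> _ /imsetP[v _ ->]; apply: cardp.
  have part : partition (porbits rho) [set: V].
    have -> : porbits rho = preim_partition pi [set: V]; last first.
      exact: preim_partitionP.
    have clE v : porbit rho v = [set w in [set: V] | pi v == pi w].
      by apply/setP=> w; rewrite porbitE !inE.
    apply/setP=> A; apply/imsetP/imsetP=> -[v _ ->]; exists v => //;
      by rewrite ?inE ?clE.
  have /eqP := card_uniform_partition cardP part.
  by rewrite cardsT cardV card_porbits eqn_pmul2l 1?ltnW // => /eqP.
- apply/imsetP; exists (porbit rho u0); first exact: imset_f.
  apply/setP=> A; apply/imsetP/imsetP=> [[u _ ->]|[_ /cycleP[k ->] ->]].
    have [k ku] := reach u0 u; exists (lambda ^+ k); first exact: mem_cycle.
    by rewrite -(porbit_eq _ _ ku) -imX.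
  by exists ((lambda ^+ k) u0); rewrite // -imX.
exists 1%N; first exact: coprime1n.
by rewrite expg1 conjgE rhoC mulKg.
Qed.

End WeakMetacirculant.

(** * The standard metacirculants *)

Section Standard.
Local Open Scope ring_scope.
Variables r s : nat.
Hypotheses (r3 : (3 <= r)%N) (s3 : (3 <= s)%N).

Let r1 : (1 < r)%N. Proof. exact: leq_trans r3. Qed.
Let s1 : (1 < s)%N. Proof. exact: leq_trans s3. Qed.

Lemma mu_expE n p : (mu r s ^+ n)%g p = (p.1 + n%:R, p.2).
Proof.
elim: n => [|n IHn]; first by rewrite perm1 addr0; case: p.
by rewrite expgSr permM IHn permE /= -addrA natr1.
Qed.

Lemma nu_expE n p : (nu r s ^+ n)%g p = (p.1, p.2 + n%:R).
Proof.
elim: n => [|n IHn]; first by rewrite perm1 addr0; case: p.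
by rewrite expgSr permM IHn permE /= -addrA natr1.
Qed.

Lemma std_connect_diag n (p : stdX r s) :
  connect (@std_adj r s) p (p.1 + n%:R, p.2 + n%:R).
Proof.
elim: n => [|n IHn]; first by rewrite !addr0 -surjective_pairing.
apply: connect_trans IHn (connect1 _).
by rewrite std_adjE /= -!natr1 !addrA ![_ + 1]addrC !addrK !sign1.
Qed.

(** A step up followed by a step down, both to the right, advances the first coordinate by 2. *)
Lemma std_connect_even n (p : stdX r s) :
  connect (@std_adj r s) p (p.1 + n.*2%:R, p.2).
Proof.
elim: n => [|n IHn]; first by rewrite !addr0 -surjective_pairing.
apply: connect_trans IHn _.
apply: (@connect_trans _ _ (p.1 + n.*2%:R + 1, p.2 + 1)); apply: connect1.
  by rewrite std_adjE /= ![_ + 1]addrC !addrK !sign1.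
rewrite std_adjE /= -!natr1 !addrA ![_ + 1]addrC !addrK sign1 /=.
by rewrite opprD addrCA subrr addr0 signN sign1.
Qed.

(** Take [l] diagonal steps, then move horizontally by [k - l]. Modulo [r] this is represented by
    the natural number [k + l * r.-1], whose evenness permits steps of 2. *)
Lemma std_connect (k l : nat) (p : stdX r s) : ~~ odd (k + l * r.-1) ->
  connect (@std_adj r s) p (p.1 + k%:R, p.2 + l%:R).
Proof.
move=> ev; apply: connect_trans (std_connect_diag l p) _.
have -> : p.1 + k%:R = p.1 + l%:R + ((k + l * r.-1)./2).*2%:R :> 'Z_r.
  rewrite even_halfK // -addrA -natrD addnCA -mulnS prednK ?(ltn_trans _ r1) //.
  by rewrite natrD natrM pchar_Zp // mulr0 addr0.
exact: (std_connect_even _ (_, _)).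
Qed.

(** If the parity is wrong, it is repaired without changing residues: add [r] to [k] when [r] is
    odd, and otherwise add [s] to [l], where [s] and [r.-1] are both odd. *)
Lemma std_connected : odd r || odd s ->
  forall p q : stdX r s, connect (@std_adj r s) p q.
Proof.
move=> ors p q; pose k := nat_of_ord (q.1 - p.1)%R.
pose l := nat_of_ord (q.2 - p.2)%R.
suff [k' [l' [kE lE ev]]] : exists k' l' : nat,
    [/\ k'%:R = q.1 - p.1 :> 'Z_r, l'%:R = q.2 - p.2 :> 'Z_s
      & ~~ odd (k' + l' * r.-1)].
  have := std_connect p ev; rewrite kE lE !(addrC _ (_ - _)) !subrK.
  by rewrite -surjective_pairing.
have kE : k%:R = q.1 - p.1 :> 'Z_r by apply: natr_Zp.
have lE : l%:R = q.2 - p.2 :> 'Z_s by apply: natr_Zp.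
have r0 : (0 < r)%N by apply: ltn_trans r1.
have [par|par] := boolP (odd (k + l * r.-1)); last by exists k, l.
have [or|er] := boolP (odd r).
  exists (k + r)%N, l; split; rewrite ?natrD ?pchar_Zp ?addr0 //.
  by rewrite addnAC oddD par or.
rewrite (negPf er) /= in ors.
exists k, (l + s)%N; split; rewrite ?natrD ?pchar_Zp ?addr0 //.
have er' : odd r.-1 by move: er; rewrite -{1}(prednK r0) oddS negbK.
by rewrite mulnDl addnA oddD par oddM ors er'.
Qed.

(** An affine map is a product of powers of [mu] and [nu], preceded by [sigma] when its sign is
    -1. *)
Lemma std_groupP (ors : odd r || odd s) p :
  p \in std_group r s <-> affine (V := stdX r s) (r := r) (s := s) id p.
Proof.
have gen x : x \in [set mu r s; nu r s; sigma r s] -> x \in std_group r s.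
  exact: mem_gen.
split=> [|[d [c [c' [sd pE]]]]].
  apply: affine_group_gen => x; rewrite !inE => /orP[/orP[]|] /eqP->.
  - by exists 1, 1, 0; split=> [|u]; rewrite ?sign1 // permE mul1r addr0.
  - by exists 1, 0, 1; split=> [|u]; rewrite ?sign1 // permE mul1r addr0.
  exists (-1), 0, 0; split=> [|u]; first by rewrite signN sign1.
  by rewrite permE mulN1r !addr0.
have tG : (mu r s ^+ c * nu r s ^+ c')%g \in std_group r s.
  by rewrite groupM ?groupX ?gen // !inE eqxx ?orbT.
have tE u : (mu r s ^+ c * nu r s ^+ c')%g u = (u.1 + c, u.2 + c').
  by rewrite permM nu_expE mu_expE !natr_Zp.
have [dE|dE] := signP sd; rewrite dE in pE.
  suff -> : p = (mu r s ^+ c * nu r s ^+ c')%g by [].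
  by apply/permP=> u; rewrite pE tE mul1r.
suff -> : p = (sigma r s * (mu r s ^+ c * nu r s ^+ c'))%g.
  by apply: groupM => //; apply: gen; rewrite !inE eqxx orbT.
by apply/permP=> u; rewrite pE permM tE permE mulN1r.
Qed.

Lemma std_model_id : odd r || odd s ->
  std_model (V := stdX r s) (r := r) (s := s) id (std_group r s).
Proof.
move=> ors; split=> //.
- by constructor; exact: (0, 0).
- by move=> u v w d sd; exists (d * (w.1 - u.1) + v.1, w.2 - u.2 + v.2).
- by move=> u q; exists q.
- exact: std_connected.
exact: std_groupP.
Qed.

Lemma std_OG4 : odd r || odd s ->
  OG4 (@std_adj r s) (std_group r s) (std_arcs r s).
Proof.
move=> ors; have := model_OG4 r3 s3 (std_model_id ors).
have -> // : model_arcs (V := stdX r s) id = std_arcs r s.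
by apply/setP=> -[u v]; rewrite inE.
Qed.

Lemma std_weak_metacirculant : odd r || odd s ->
  weak_metacirculant s r (@std_adj r s) (mu r s) (nu r s).
Proof.
move=> ors; have /subsetP HA := OG4_aut (std_OG4 ors).
apply: (weak_metacirculant_levels (pi := fun u : stdX r s => u.2)) => //.
- by constructor; exact: (0, 0).
- by apply/HA/mem_gen; rewrite !inE eqxx.
- by apply/HA/mem_gen; rewrite !inE eqxx ?orbT.
- by rewrite card_prod !card_ord !Zp_cast // mulnC.
- move=> u v; apply/porbitP/eqP=> [[n ->]|uv]; first by rewrite mu_expE.
  exists (v.1 - u.1)%R; rewrite mu_expE natr_Zp addrC subrK uv.
  exact: surjective_pairing.
- by move=> u; rewrite permE.
by apply/permP=> u; rewrite !permM !permE.
Qed.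

End Standard.

(** * Parity modulo an even number *)

Section Parity.
Local Open Scope ring_scope.
Variable p : nat.
Hypotheses (p1 : (1 < p)%N) (ev : ~~ odd p).
Implicit Types x y d : 'Z_p.

(** Reduction modulo an even number keeps parity; [(Zp_trunc p).+2] is the modulus by which ['Z_p]
    is defined. *)
Lemma odd_Zp_mod n : odd (n %% (Zp_trunc p).+2) = odd n.
Proof. by rewrite odd_mod // Zp_cast // (negPf ev). Qed.

Lemma odd_ZpD x y : odd (x + y)%R = odd x (+) odd y.
Proof. by rewrite odd_Zp_mod oddD. Qed.

Lemma odd_Zp1 : odd (1%R : 'Z_p).
Proof. by rewrite odd_Zp_mod. Qed.

Lemma odd_ZpN x : odd (- x)%R = odd x.
Proof.
have := odd_ZpD (- x) x; rewrite addNr /= => /esym.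
by case: (odd x); case: (odd _).
Qed.

Lemma odd_Zp_sign d : sign d -> odd d.
Proof. by case/signP=> ->; rewrite ?odd_ZpN odd_Zp1. Qed.

Lemma odd_Zp_signM d x : sign d -> odd (d * x)%R = odd x.
Proof. by case/signP=> ->; rewrite ?mul1r // mulN1r odd_ZpN. Qed.

End Parity.

(** * The even case: the component of equal parities *)

Section StandardEven.
Local Open Scope ring_scope.
Variables r s : nat.
Hypotheses (r3 : (3 <= r)%N) (s3 : (3 <= s)%N) (er : ~~ odd r) (es : ~~ odd s).

Let r1 : (1 < r)%N. Proof. exact: leq_trans r3. Qed.
Let s1 : (1 < s)%N. Proof. exact: leq_trans s3. Qed.

Let vl (u : stdXp r s) : stdX r s := val u.

Lemma same_parityE (i : 'Z_r) (j : 'Z_s) :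
  same_parity ((i, j) : stdX r s) = (odd i == odd j).
Proof. by []. Qed.

Lemma same_parity_adj (p q : stdX r s) :
  std_adj p q -> same_parity q = same_parity p.
Proof.
rewrite std_adjE => /andP[s_1 s_2]; rewrite /same_parity.
rewrite -[q.1](subrK p.1) -[q.2](subrK p.2) odd_ZpD // (odd_Zp_sign r1 er s_1).
rewrite odd_ZpD // (odd_Zp_sign s1 es s_2).
exact: (inj_eq negb_inj).
Qed.

Lemma same_parity_mu p : same_parity (mu r s p) = ~~ same_parity p.
Proof.
transitivity (odd (p.1 + 1)%R == odd p.2); first by rewrite permE.
by rewrite odd_ZpD // odd_Zp1 // addbT /same_parity; case: odd; case: odd.
Qed.

Lemma same_parity_nu p : same_parity (nu r s p) = ~~ same_parity p.
Proof.
transitivity (odd p.1 == odd (p.2 + 1)%R); first by rewrite permE.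
by rewrite odd_ZpD // odd_Zp1 // addbT /same_parity; case: odd; case: odd.
Qed.

Lemma same_parity_sigma p : same_parity (sigma r s p) = same_parity p.
Proof.
transitivity (odd (- p.1)%R == odd p.2); first by rewrite permE.
by rewrite odd_ZpN.
Qed.

Lemma std_mu2E (u : stdXp r s) :
  val (std_mu2 r s u) = ((val u).1 + 1 + 1, (val u).2).
Proof.
rewrite stdp_restrE => [|x]; first by rewrite mu_expE -addrA.
by rewrite expgS expg1 permM !same_parity_mu negbK.
Qed.

Lemma std_munuE (u : stdXp r s) :
  val (std_munu r s u) = ((val u).1 + 1, (val u).2 + 1).
Proof.
rewrite stdp_restrE => [|x]; first by rewrite permM !permE.
by rewrite permM same_parity_nu same_parity_mu negbK.
Qed.

Lemma std_sigmaE (u : stdXp r s) :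
  val (std_sigma r s u) = (- (val u).1, (val u).2).
Proof.
rewrite stdp_restrE => [|x]; first by rewrite permE.
exact: same_parity_sigma.
Qed.

Lemma std_mu2_expE n (u : stdXp r s) :
  val ((std_mu2 r s ^+ n)%g u) = ((val u).1 + n.*2%:R, (val u).2).
Proof.
elim: n => [|n IHn]; first by rewrite perm1 addr0 -surjective_pairing.
by rewrite expgSr permM std_mu2E IHn doubleS -!natr1 !addrA.
Qed.

Lemma std_munu_expE n (u : stdXp r s) :
  val ((std_munu r s ^+ n)%g u) = ((val u).1 + n%:R, (val u).2 + n%:R).
Proof.
elim: n => [|n IHn]; first by rewrite perm1 !addr0 -surjective_pairing.
by rewrite expgSr permM std_munuE IHn -!natr1 !addrA.
Qed.

(** Every edge changes both coordinates by odd amounts, so a path that starts among vertices of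
    equal parity stays there. *)
Lemma stdp_connect (u v : stdXp r s) :
  connect (@std_adj r s) (val u) (val v) -> connect (@stdp_adj r s) u v.
Proof.
case/connectP=> c; elim: c u => [|q c IHc] u /=.
  by move=> _ /val_inj->.
case/andP=> uq cq vE; have pq : same_parity q.
  by rewrite (same_parity_adj uq) (valP u).
apply: (@connect_trans _ _ (Sub q pq : stdXp r s)).
  by apply: connect1; rewrite /stdp_adj SubK.
by apply: IHc; rewrite SubK.
Qed.

Lemma even_path_parity (k : 'Z_r) (l : 'Z_s) :
  odd k = odd l -> ~~ odd (k + l * r.-1).
Proof.
move=> kl; have or : odd r.-1.
  by move: er; rewrite -{1}(prednK (ltnW r1)) oddS negbK.
by rewrite oddD oddM or andbT kl addbb.
Qed.

Lemma stdp_connected (u v : stdXp r s) : connect (@stdp_adj r s) u v.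
Proof.
apply: stdp_connect.
have := std_connect r3 (val u)
  (@even_path_parity ((val v).1 - (val u).1) ((val v).2 - (val u).2) _).
rewrite !natr_Zp ![(val u).1 + _]addrC ![(val u).2 + _]addrC !subrK.
rewrite -surjective_pairing; apply; rewrite !odd_ZpD // !odd_ZpN //.
by rewrite (eqP (valP u)) (eqP (valP v)).
Qed.

Lemma stdp_groupP p :
  p \in stdp_group r s <-> affine vl p.
Proof.
have gen x : x \in [set std_mu2 r s; std_munu r s; std_sigma r s] ->
    x \in stdp_group r s.
  exact: mem_gen.
split=> [|[d [c [c' [sd pE]]]]].
  apply: affine_group_gen => x; rewrite !inE => /orP[/orP[]|] /eqP->.
  - exists 1, (1 + 1), 0; split=> [|u]; first exact: sign1.
    by rewrite /vl std_mu2E mul1r addr0 addrA.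
  - exists 1, 1, 1; split=> [|u]; first exact: sign1.
    by rewrite /vl std_munuE mul1r.
  exists (-1), 0, 0; split=> [|u]; first by rewrite signN sign1.
  by rewrite /vl std_sigmaE mulN1r !addr0.
(* The image of the origin is [(c, c')], which must again have equal parities. *)
have cc' : odd c = odd c'.
  have sp0 : same_parity (0 : 'Z_r, 0 : 'Z_s) by [].
  have := valP (p (Sub _ sp0)); rewrite -/(vl _) pE /vl SubK mulr0 !add0r.
  by move/eqP.
(* After [c'] diagonal steps the first coordinate still lacks [c - c'], represented by the even
   number [c + c' * r.-1]; [std_mu2] covers it in steps of 2. *)
pose k := ((c + c' * r.-1)./2)%N.
pose t : {perm stdXp r s} := (std_munu r s ^+ c' * std_mu2 r s ^+ k)%g.
have tG : t \in stdp_group r s.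
  by rewrite groupM ?groupX ?gen // !inE eqxx ?orbT.
have tE u : vl (t u) = ((vl u).1 + c, (vl u).2 + c').
  rewrite /vl permM std_mu2_expE std_munu_expE /= natr_Zp -addrA -natrD.
  rewrite even_halfK; last exact: even_path_parity.
  rewrite addnCA -mulnS prednK ?(ltnW r1) //.
  by rewrite natrD natrM pchar_Zp // mulr0 addr0 natr_Zp.
have [dE|dE] := signP sd; rewrite dE in pE.
  suff -> : p = t by [].
  by apply/permP=> u; apply: val_inj; rewrite -!/(vl _) pE tE mul1r.
suff -> : p = (std_sigma r s * t)%g.
  by apply: groupM => //; apply: gen; rewrite !inE eqxx orbT.
apply/permP=> u; apply: val_inj; rewrite -!/(vl _) pE permM tE.
by rewrite /vl std_sigmaE mulN1r.
Qed.

Lemma stdp_model : std_model vl (stdp_group r s).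
Proof.
have sp0 : same_parity (0 : 'Z_r, 0 : 'Z_s) by [].
split.
- exact: val_inj.
- by constructor; exact: Sub _ sp0.
- move=> u v w d sd.
  suff spz : same_parity (d * ((vl w).1 - (vl u).1) + (vl v).1,
                          (vl w).2 - (vl u).2 + (vl v).2).
    by exists (Sub _ spz); rewrite /vl SubK.
  rewrite same_parityE !odd_ZpD // odd_Zp_signM // !odd_ZpD // !odd_ZpN //.
  by rewrite (eqP (valP u)) (eqP (valP v)) (eqP (valP w)).
- move=> u q uq; have spq : same_parity q.
    by rewrite (same_parity_adj uq) (valP u).
  by exists (Sub q spq); rewrite /vl SubK.
- exact: stdp_connected.
exact: stdp_groupP.
Qed.

Lemma stdp_OG4 : OG4 (@stdp_adj r s) (stdp_group r s) (stdp_arcs r s).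
Proof. exact: (model_OG4 r3 s3 stdp_model). Qed.

(** [mu] exchanges the vertices of equal parity with the others, so they are half of all [r * s]
    vertices. *)
Lemma card_stdXp : #|stdXp r s| = (s * r./2)%N.
Proof.
pose A := [set p : stdX r s | same_parity p].
have cA : #|stdXp r s| = #|A| by rewrite card_sig cardsE.
have cC : #|~: A| = #|A|.
  rewrite -(card_imset A (@perm_inj _ (mu r s))); apply: eq_card => p.
  apply/idP/imsetP=> [|[q]]; rewrite !inE.
    move=> np; exists ((mu r s)^-1%g p); last by rewrite permKV.
    by rewrite inE -[same_parity _]negbK -same_parity_mu permKV.
  by move=> sq ->; rewrite same_parity_mu negbK.
have := cardsC A; rewrite cC addnn card_prod !card_ord !Zp_cast // => cA2.
by rewrite cA -[LHS]doubleK cA2 -{1}(even_halfK er) -doubleMl doubleK mulnC.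
Qed.

Lemma stdp_weak_metacirculant :
  weak_metacirculant s r./2 (@stdp_adj r s) (std_mu2 r s) (std_munu r s).
Proof.
have /subsetP HA := OG4_aut stdp_OG4.
apply: (weak_metacirculant_levels (pi := fun u : stdXp r s => (val u).2)) => //.
- by case: (model_point stdp_model).
- by apply/HA/mem_gen; rewrite !inE eqxx.
- by apply/HA/mem_gen; rewrite !inE eqxx ?orbT.
- exact: card_stdXp.
- move=> u v; apply/porbitP/eqP=> [[n ->]|uv]; first by rewrite std_mu2_expE.
  have ev : ~~ odd ((val v).1 - (val u).1)%R.
    by rewrite odd_ZpD // odd_ZpN // (eqP (valP u)) (eqP (valP v)) uv addbb.
  exists ((val v).1 - (val u).1)%R./2; apply: val_inj.
  rewrite std_mu2_expE even_halfK // natr_Zp addrC subrK uv.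
  exact: surjective_pairing.
- by move=> u; rewrite std_munuE.
apply/permP=> u; apply: val_inj.
rewrite !permM std_munuE !std_mu2E std_munuE /=.
by rewrite addrAC -!addrA.
Qed.

End StandardEven.

(** * Assembling the cover from an unoriented and an oriented quotient *)

Lemma cyclic_coord_shift (T : finType) (e : rel T) (G : {group {perm T}}) p
    (a : T -> 'Z_p) c :
  cyclic_coord e G a -> cyclic_coord e G (p := p) (fun x => a x + c)%R.
Proof.
move=> ca; split=> [x y exy|x d sd|x y /addIr/(coord_fiber ca)|g x y gG].
- by rewrite subrDr (coord_step ca).
- by have [y exy ay] := coord_nbr ca x sd; exists y; rewrite // ay addrAC.
- by case=> g [gG gE gx]; exists g; split=> // z; rewrite gE.
by move/addIr/(coord_act ca gG) => ->.
Qed.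

Lemma oriented_coord_shift (T : finType) (e : rel T) (D : {set T * T}) p
    (a : T -> 'Z_p) c :
  oriented_coord e D (p := p) (fun x => a x + c)%R -> oriented_coord e D a.
Proof.
move=> ori x y x' y' exy exy' ax ay.
by apply: ori; rewrite // ?ax ?ay.
Qed.

Lemma covers_of_oriented_unoriented
    (T : finType) (e : rel T) (G : {group {perm T}}) (D : {set T * T})
    (N M : {group {perm T}}) (r s : nat) :
    OG4 e G D -> N <| G -> M <| G -> 3 <= r -> 3 <= s ->
    quotient_is_cycle e N r -> quotient_is_cycle e M s ->
    ~ oriented_quotient e D N -> oriented_quotient e D M ->
  covers_standard_metacirculant e G r s.
Proof.
move=> hOG nNG nMG r3 s3 hN hM Nori Mori.
have [a [ca [_ oriN]]] := cyclic_coord_of_quotient hOG nNG r3 hN.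
have [b0 [cb0 [oriM _]]] := cyclic_coord_of_quotient hOG nMG s3 hM.
have [b cb arcb] := oriented_coord_arcs hOG cb0 (oriM Mori).
have Na : ~ oriented_coord e D a by move/oriN.
have [ors|] := boolP (odd r || odd s); [left | rewrite negb_or => ev; right].
  split=> //; first exact: std_OG4.
    exact: std_weak_metacirculant.
  exact: (model_normal_cover r3 s3 (std_model_id r3 s3 ors) hOG ca cb Na arcb
            (phi := fun x => (a x, b x) : stdX r s)).
have /andP[er es] := ev.
split=> //; first exact: stdp_OG4.
  exact: stdp_weak_metacirculant.
have r1 : 1 < r by apply: leq_trans r3.
have [x0 _] := arc_exists hOG.
(* Shifting [a] by [c] gives [x0] coordinates of equal parity; edges preserve this, so all of the
   connected graph maps into the component. *)
pose c : 'Z_r := if odd (a x0) == odd (b x0) then 0%R else 1%R.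
pose a' x := (a x + c)%R.
have ca' : cyclic_coord e G a' by apply: cyclic_coord_shift.
have Na' : ~ oriented_coord e D a' by move/oriented_coord_shift.
have par x : same_parity ((a' x, b x) : stdX r s).
  move: x; apply: (vertex_ind hOG (x0 := x0)) => [|x y exy].
    rewrite /a' /c; case: ifP => [ab|ab]; first by rewrite addr0.
    rewrite same_parityE odd_ZpD // odd_Zp1 // addbT.
    by case: odd ab; case: odd.
  have xy : std_adj ((a' x, b x) : stdX r s) (a' y, b y).
    by rewrite std_adjE (coord_step ca') // (coord_step cb).
  by rewrite (same_parity_adj _ _ _ _ xy).
exact: (model_normal_cover r3 s3 (stdp_model r3 s3 er es) hOG ca' cb Na' arcb
          (phi := fun x => Sub _ (par x) : stdXp r s)).
Qed.

(** The cover needs one unoriented and one oriented quotient. An oriented [M] serves directly; if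
    [M] is unoriented, the quotient modulo [<[rho]>], of length [l], takes its place and the second
    parameter becomes [l]. *)
Theorem corollary1p2
    (T : finType) (e : rel T) (G : {group {perm T}}) (D : {set T * T})
    (hOG : OG4 e G D)
    (m n : nat) (rho lambda : {perm T})
    (rhoG : rho \in G) (lambdaG : lambda \in G)
    (hmeta : weak_metacirculant m n e rho lambda)
    (l : nat) (hl : 3 <= l)
    (hRnormal : is_normal_quotient G <[rho]>)
    (hRcycle : quotient_is_cycle e <[rho]> l)
    (hRoriented : oriented_quotient e D <[rho]>)
    (N M : {group {perm T}}) (nNG : N <| G) (nMG : M <| G)
    (r s : nat) (hr : 3 <= r) (hs : 3 <= s)
    (hN : quotient_is_cycle e N r) (hM : quotient_is_cycle e M s)
    (hNM : independent_quotients e G N M)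
    (hNunoriented : ~ oriented_quotient e D N) :
  (oriented_quotient e D M -> covers_standard_metacirculant e G r s) /\
  (~ oriented_quotient e D M -> covers_standard_metacirculant e G r l).
Proof.
split=> [Mori|_]; first exact: (covers_of_oriented_unoriented hOG nNG nMG).
(* [L] is a normal subgroup with the orbits of [<[rho]>], so it inherits the cyclic and oriented
   quotient. *)
have [L nLG LR] := hRnormal.
apply: (covers_of_oriented_unoriented hOG nNG nLG) => //.
  exact: quotient_is_cycle_orbits hRcycle.
exact: oriented_quotient_orbits hRoriented.
Qed.
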